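(* Let $(X,\sigma)$ and $(Y,\tau)$ be odometers on Cantor sets $X$ and $Y$. Then $(C(X),\sigma)\equiv(C(Y),\tau)$ (elementary equivalence as $\mathcal{L}$-structures) if and only if $(C(X),\sigma)\cong(C(Y),\tau)$.
   Context: Let $\mathcal{L}_{C^*}$ be the language of unital C*-algebras (continuous logic) and $\mathcal{L}$ its expansion by a unary function symbol $\sigma$. A compact space $X$ with a homeomorphism $S$ corresponds to the $\mathcal{L}$-structure $(C(X),\sigma)$ with $\sigma(f)=f\circ S$. Odometers: given integers $a_n\ge 2$ ($n\ge1$), let $A_n=\{0,\dots,a_n-1\}$ and $X=\prod_n A_n$ with the product topology; define $\sigma:X\to X$ by: if $b_1<a_1-1$ then $\sigma(b)=(b_1+1,b_2,\dots)$; otherwise $\sigma(b)=(0,\dots,0,b_n+1,b_{n+1},\dots)$ where $n$ is least with $b_n<a_n-1$, and $\sigma(b)=(0,0,\dots)$ if no such $n$ exists. An odometer is any system topologically conjugate to such a $(\prod A_n,\sigma)$. *)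

(* Defs.v *)
From mathcomp Require Import all_boot all_order all_algebra.
From mathcomp Require Import complex.
From mathcomp Require Import all_classical all_reals all_analysis.

Set Implicit Arguments.
Unset Strict Implicit.
Unset Printing Implicit Defensive.

Import Order.TTheory GRing.Theory Num.Theory.
Import numFieldNormedType.Exports.
Import ComplexField.Normc.

Local Open Scope classical_set_scope.
Local Open Scope ring_scope.
Local Open Scope complex_scope.

Section Language.
Variable R : realType.

(* Interpretations of the symbols of the language.  The metric is
   [d(x, y) = ||x - y||], so the norm is the only predicate symbol needed. *)
Record Lstructure : Type := MkLstructure {
  Lsort :> Type;
  L_zero : Lsort;
  L_one : Lsort;
  L_add : Lsort -> Lsort -> Lsort;
  L_mul : Lsort -> Lsort -> Lsort;
  L_star : Lsort -> Lsort;
  L_scale : R[i] -> Lsort -> Lsort;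
  L_sigma : Lsort -> Lsort;
  L_norm : Lsort -> R }.

(* Variables are de Bruijn indices: [term k] and [formula k] have their free
   variables among ['I_k], and a quantifier binds the index [ord0]. *)
Inductive term (k : nat) : Type :=
| TVar of 'I_k
| TZero
| TOne
| TAdd of term k & term k
| TMul of term k & term k
| TStar of term k
| TScale of R[i] & term k
| TSigma of term k.

(* Connectives are all continuous functions [R^m -> R]; quantifiers range over
   the closed ball of radius [n], for [n] a natural number. *)
Inductive formula (k : nat) : Type :=
| FNorm of term k
| FConn (m : nat) of continuousType {ptws 'I_m -> R} R & 'I_m -> formula k
| FSup (n : nat) of formula k.+1
| FInf (n : nat) of formula k.+1.

Definition sentence := formula 0.

Variable M : Lstructure.

Fixpoint eval_term k (v : 'I_k -> M) (t : term k) : M :=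
  match t with
  | TVar i => v i
  | TZero => L_zero M
  | TOne => L_one M
  | TAdd t1 t2 => L_add (eval_term v t1) (eval_term v t2)
  | TMul t1 t2 => L_mul (eval_term v t1) (eval_term v t2)
  | TStar t1 => L_star (eval_term v t1)
  | TScale c t1 => L_scale c (eval_term v t1)
  | TSigma t1 => L_sigma (eval_term v t1)
  end.

Definition L_ball (n : nat) : set M := [set x | L_norm x <= n%:R].

Definition extend k (x : M) (v : 'I_k -> M) : 'I_k.+1 -> M :=
  fun i => oapp v x (unlift ord0 i).

(* [sup] and [inf] are the real-valued ones, with default value 0 on unbounded
   sets; over C(X) with X compact, formulas are bounded on bounded balls. *)
Fixpoint eval_formula k (phi : formula k) : ('I_k -> M) -> R :=
  match phi with
  | FNorm t => fun v => L_norm (eval_term v t)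
  | FConn m f phis => fun v => f (fun j => eval_formula (phis j) v)
  | FSup n psi => fun v => sup [set eval_formula psi (extend x v) | x in L_ball n]
  | FInf n psi => fun v => inf [set eval_formula psi (extend x v) | x in L_ball n]
  end.

Definition no_var : 'I_0 -> M := fun i => False_rect M (notF (ltn_ord i)).

Definition sentence_value (phi : sentence) : R := eval_formula phi no_var.

End Language.

Definition elementarily_equivalent (R : realType) (M N : Lstructure R) : Prop :=
  forall phi : sentence R, sentence_value M phi = sentence_value N phi.

Record is_isomorphism (R : realType) (M N : Lstructure R) (F : M -> N) : Prop :=
  MkIsomorphism {
  iso_bij : bijective F;
  iso_zero : F (L_zero M) = L_zero N;
  iso_one : F (L_one M) = L_one N;
  iso_add : forall x y, F (L_add x y) = L_add (F x) (F y);
  iso_mul : forall x y, F (L_mul x y) = L_mul (F x) (F y);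
  iso_star : forall x, F (L_star x) = L_star (F x);
  iso_scale : forall c x, F (L_scale c x) = L_scale c (F x);
  iso_sigma : forall x, F (L_sigma x) = L_sigma (F x);
  iso_norm : forall x, L_norm (F x) = L_norm x }.

Definition isomorphic (R : realType) (M N : Lstructure R) : Prop :=
  exists F : M -> N, is_isomorphism F.

Record homeo (X Y : topologicalType) : Type := Homeo {
  homeo_fun :> continuousType X Y;
  homeo_inv : continuousType Y X;
  homeo_funK : cancel homeo_fun homeo_inv;
  homeo_invK : cancel homeo_inv homeo_fun }.

Definition is_cantor_set (X : topologicalType) : Prop :=
  inhabited (homeo X cantor_space).

Definition odometer_space (a : nat -> nat) : topologicalType :=
  prod_topology (fun n => discrete_topology 'I_(a n)).

(* Coordinates are indexed from 0.  The successor [ordS] is cyclic, but it is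
   only applied at a digit below [(a n).-1], where there is no wraparound. *)
Definition odometer_map (a : nat -> nat) (a_ge2 : forall n, (2 <= a n)%N)
    (b : odometer_space a) : odometer_space a :=
  let zero k : 'I_(a k) := Ordinal (ltnW (a_ge2 k)) in
  match pselect (exists n, (b n < (a n).-1)%N) with
  | left ex => fun k =>
      let n := ex_minn ex in
      if (k < n)%N then zero k else if k == n then ordS (b k) else b k
  | right _ => zero
  end.

Definition is_odometer (X : topologicalType) (S : homeo X X) : Prop :=
  exists (a : nat -> nat) (a_ge2 : forall n, (2 <= a n)%N)
         (h : homeo X (odometer_space a)),
    forall x, h (S x) = odometer_map a_ge2 (h x).

Section ContinuousFunctions.
Variables (R : realType) (X : topologicalType).

(* [R[i]^o] is the complex numbers with the topology of their norm. *)
Definition CX := continuousType X (R[i]^o : topologicalType).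
Implicit Types f g : CX.

Lemma CX_cvg f (x : X) : f y @[y --> x] --> f x.
Proof. exact: (@cts_fun X _ f x). Qed.

Lemma CX_add_continuous f g : continuous ((fun x => f x + g x) : X -> R[i]^o).
Proof. by move=> x; apply: (@cvgD _ R[i]^o); exact: CX_cvg. Qed.

Lemma CX_mul_continuous f g : continuous ((fun x => f x * g x) : X -> R[i]^o).
Proof. by move=> x; apply: (@cvgM R[i]); exact: CX_cvg. Qed.

Lemma CX_scale_continuous (c : R[i]) f :
  continuous ((fun x => c * f x) : X -> R[i]^o).
Proof.
by move=> x; apply: (@cvgM R[i]); [exact: cvg_cst | exact: CX_cvg].
Qed.

Lemma CX_star_continuous f : continuous ((fun x => (f x)^*) : X -> R[i]^o).
Proof.
move=> x; apply/(@cvgrPdist_lt _ R[i]^o) => e e0.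
have /(@cvgrPdist_lt _ R[i]^o)/(_ e e0) := @CX_cvg f x.
apply: filterS => y /= fxy.
have E : `|(f x)^* - (f y)^*| = `|(f x - f y : R[i])| by rewrite -rmorphB normcJ.
exact: (eq_ind_r (fun z => z < e) fxy E).
Qed.

Definition CX_add f g : CX := mkcts (@CX_add_continuous f g).
Definition CX_mul f g : CX := mkcts (@CX_mul_continuous f g).
Definition CX_scale c f : CX := mkcts (@CX_scale_continuous c f).
Definition CX_star f : CX := mkcts (@CX_star_continuous f).
Definition CX_norm f : R := sup (range (fun x => normc (f x))).

Definition C_of (S : homeo X X) : Lstructure R :=
  {| Lsort := CX;
     L_zero := cst 0 : CX;
     L_one := cst 1 : CX;
     L_add := CX_add;
     L_mul := CX_mul;
     L_star := CX_star;
     L_scale := CX_scale;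
     L_sigma := fun f => f \o S : CX;
     L_norm := CX_norm |}.

End ContinuousFunctions.

(* Main.v *)
Require Import Defs.
From mathcomp Require Import all_boot all_order all_algebra.
From mathcomp Require Import all_classical all_reals all_analysis.
From mathcomp Require Import complex zify ring lra.

(** An odometer is the successor map on an inverse limit of cyclic groups
    [Z/P n], and up to conjugacy it is determined by the set of integers that
    divide some [P n].  An integer [d] belongs to this set iff the space splits
    into [d] clopen pieces permuted cyclically, i.e. iff there is a projection
    [f] with [f + sigma f + ... + sigma^(d-1) f = 1].  As these relations are
    stable under small perturbations, this is expressed by the vanishing of the
    sentence [inf_f || |f^2 - f|^2 + |f + ... + sigma^(d-1) f - 1|^2 ||]. *)

Set Implicit Arguments.
Unset Strict Implicit.
Unset Printing Implicit Defensive.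

Import Order.TTheory GRing.Theory Num.Theory.
Import numFieldNormedType.Exports.
Import ComplexField.Normc.

Local Open Scope classical_set_scope.

(* [v n x] is the class of [x] modulo [P n]: the conditions say that [v] identifies
   [(X, S)] with the inverse limit of the [Z/P n] and the successor map. *)
Record residue_system (X : topologicalType) (S : X -> X) (P : nat -> nat)
    (v : nat -> X -> nat) : Prop := ResidueSystem {
  rs_gt0 : forall n, 0 < P n;
  rs_dvd : forall n, P n %| P n.+1;
  rs_lt : forall n x, v n x < P n;
  rs_coh : forall n x, v n x = v n.+1 x %% P n;
  rs_succ : forall n x, v n (S x) = (v n x).+1 %% P n;
  rs_near : forall n x, nbhs x [set y | v n y = v n x];
  rs_basis : forall x U, nbhs x U -> exists n, [set y | v n y = v n x] `<=` U;
  rs_inj : forall x y, (forall n, v n x = v n y) -> x = y;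
  rs_complete : forall c : nat -> nat, (forall n, c n < P n) ->
    (forall n, c n = c n.+1 %% P n) -> exists x, forall n, v n x = c n }.

(** * Odometers as inverse limits of cyclic groups *)

Section OdometerResidues.
Variables (a : nat -> nat) (a_ge2 : forall n, 2 <= a n).

Definition odo_period n := \prod_(k < n) a k.

(** The first [n] digits in mixed radix, least significant first, so that the odometer map becomes
    adding 1 with carry. *)
Definition odo_residue n (b : odometer_space a) := \sum_(k < n) b k * odo_period k.

Lemma odo_periodS n : odo_period n.+1 = odo_period n * a n.
Proof. by rewrite /odo_period big_ord_recr. Qed.

Lemma odo_period_gt0 n : 0 < odo_period n.
Proof. by rewrite prodn_gt0 // => k; exact: ltnW. Qed.

Lemma odo_residueS n b :
  odo_residue n.+1 b = odo_residue n b + b n * odo_period n.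
Proof. by rewrite /odo_residue big_ord_recr. Qed.

Lemma odo_residue_lt n b : odo_residue n b < odo_period n.
Proof.
elim: n => [|n IHn]; first by rewrite /odo_residue /odo_period !big_ord0.
rewrite odo_residueS odo_periodS.
have : (b n).+1 * odo_period n <= odo_period n * a n.
  by rewrite mulnC; apply: leq_mul; rewrite ?ltn_ord.
by rewrite mulSn; apply: leq_trans; rewrite ltn_add2r IHn.
Qed.

Lemma odo_residue_coh n b : odo_residue n b = odo_residue n.+1 b %% odo_period n.
Proof. by rewrite odo_residueS addnC modnMDl modn_small ?odo_residue_lt. Qed.

Lemma odo_residue_max n (b : odometer_space a) :
  (forall k, k < n -> (b k : nat) = (a k).-1) ->
  (odo_residue n b).+1 = odo_period n.
Proof.
elim: n => [|n IHn] bmax; first by rewrite /odo_residue /odo_period !big_ord0.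
rewrite odo_residueS odo_periodS -addSn IHn => [|k kn]; last exact/bmax/ltnW.
by rewrite bmax // -mulSn prednK 1?mulnC // ltnW.
Qed.

Lemma odo_residue0 n (b : odometer_space a) :
  (forall k, k < n -> (b k : nat) = 0) -> odo_residue n b = 0.
Proof. by move=> b0; rewrite /odo_residue big1 // => k _; rewrite b0. Qed.

Lemma odo_digit_max k (b : odometer_space a) :
  ~~ (b k < (a k).-1) -> (b k : nat) = (a k).-1.
Proof. by move: (ltn_ord (b k)) (a_ge2 k); lia. Qed.

Lemma odo_residue_map n b :
  odo_residue n (odometer_map a_ge2 b) = (odo_residue n b).+1 %% odo_period n.
Proof.
rewrite /odometer_map; case: pselect => [ex|nex]; last first.
  rewrite odo_residue0 // odo_residue_max ?modnn // => k _.
  by apply: odo_digit_max; apply/negP => bk; apply: nex; exists k.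
case: ex_minnP => j bj jmin.
set c := fun k => _.
have bmax k : k < j -> (b k : nat) = (a k).-1.
  by move=> kj; apply: odo_digit_max; apply: contraL kj => /jmin; rewrite leqNgt.
(* The carry stops at digit [j]. For [n <= j] the first [n] digits are all maximal and turn to 0;
   beyond [j] the residue grows by exactly 1, without reduction. *)
have [nj|jn] := leqP n j.
  rewrite odo_residue0 ?odo_residue_max ?modnn // => k kn.
    by rewrite bmax // (leq_trans kn).
  by rewrite /c (leq_trans kn).
suff E : odo_residue n c = (odo_residue n b).+1.
  by rewrite -E modn_small ?odo_residue_lt.
elim: n jn => // n IHn; rewrite ltnS leq_eqVlt => /orP[/eqP <-|jn].
  (* The digits below [j] lose [odo_period j - 1], and the increment of digit [j] gains
     [odo_period j]. *)
  rewrite !odo_residueS odo_residue0; last by move=> k kj; rewrite /c kj.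
  rewrite -addSn odo_residue_max // add0n /c ltnn eqxx /= modn_small.
    by rewrite mulSn.
  by move: bj; lia.
by rewrite !odo_residueS IHn // /c ltnNge ltnW //= gtn_eqF.
Qed.

Lemma odo_residue_near n b : nbhs b [set c | odo_residue n c = odo_residue n b].
Proof.
elim: n => [|n IHn].
  by apply: filterS filterT => c _; rewrite /= /odo_residue !big_ord0.
have bn : nbhs b [set c : odometer_space a | c n = b n].
  have := @proj_continuous _ (fun n => discrete_topology 'I_(a n)) n b.
  by move=> /(_ [set b n]); apply; exact: (@discrete_set1 (discrete_topology 'I_(a n))).
by apply: filterS2 IHn bn => c /= IH E; rewrite !odo_residueS IH E.
Qed.

Lemma odo_residue_digit n b c : odo_residue n b = odo_residue n c ->
  odo_residue n.+1 b = odo_residue n.+1 c -> b n = c n.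
Proof.
rewrite !odo_residueS => -> /eqP; rewrite eqn_add2l eqn_mul2r.
by rewrite -[X in X || _]negbK -lt0n odo_period_gt0 /= => /eqP/val_inj.
Qed.

Lemma odo_residue_le m n b c : m <= n -> odo_residue n b = odo_residue n c ->
  odo_residue m b = odo_residue m c.
Proof.
move=> /subnK <-; elim: (n - m) => // k IHk; rewrite addSn => E.
by apply: IHk; rewrite odo_residue_coh E -odo_residue_coh.
Qed.

Lemma odo_residue_basis b U : nbhs b U ->
  exists n, [set c | odo_residue n c = odo_residue n b] `<=` U.
Proof.
pose F := filter_from setT (fun n => [set c | odo_residue n c = odo_residue n b]).
have FF : Filter F.
  apply: filter_from_filter; first by exists 0.
  move=> m n _ _; exists (maxn m n) => // c /= E.
  split; apply: odo_residue_le E; [exact: leq_maxl|exact: leq_maxr].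
have Fb : F --> b.
  (* The product topology is a supremum over the coordinates, and coordinate [k] can be read off the
     residue at level [k.+1]. *)
  apply/cvg_sup => k V [_ [[W _ <-] Wb] WV].
  exists k.+1 => // c /= E; apply: WV => /=.
  by rewrite (odo_residue_digit _ E) //; exact: odo_residue_le E.
by move=> /Fb [n _ nU]; exists n.
Qed.

Lemma odo_residue_complete (c : nat -> nat) : (forall n, c n < odo_period n) ->
  (forall n, c n = c n.+1 %% odo_period n) ->
  exists b, forall n, odo_residue n b = c n.
Proof.
move=> c_lt c_coh.
(* These quotients are the digits of the point sought. *)
have bP n : c n.+1 %/ odo_period n < a n.
  by rewrite ltn_divLR ?odo_period_gt0 // mulnC -odo_periodS.
exists (fun n => Ordinal (bP n)); elim=> [|n IHn].
  have := c_lt 0; rewrite /odo_residue /odo_period !big_ord0.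
  by case: (c 0).
by rewrite odo_residueS IHn c_coh addnC -divn_eq.
Qed.

Lemma odometer_residue_system :
  residue_system (odometer_map a_ge2) odo_period odo_residue.
Proof.
split.
- exact: odo_period_gt0.
- by move=> n; rewrite odo_periodS dvdn_mulr.
- exact: odo_residue_lt.
- exact: odo_residue_coh.
- exact: odo_residue_map.
- exact: odo_residue_near.
- exact: odo_residue_basis.
- move=> b c E; apply: functional_extensionality_dep => n.
  exact: odo_residue_digit.
- exact: odo_residue_complete.
Qed.

End OdometerResidues.

Lemma is_odometer_residue_system (X : topologicalType) (S : homeo X X) :
  is_odometer S -> exists P v, residue_system S P v.
Proof.
move=> [a [a_ge2 [h hS]]].
have R := odometer_residue_system a_ge2.
exists (odo_period a), (fun n x => odo_residue n (h x)); split.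
- exact: rs_gt0 R.
- exact: rs_dvd R.
- by move=> n x; exact: (rs_lt R).
- by move=> n x; exact: (rs_coh R).
- by move=> n x; rewrite hS (rs_succ R).
- by move=> n x; exact: (@cts_fun _ _ h x _ (rs_near R n (h x))).
- move=> x U xU; have : nbhs (h x) (homeo_inv h @^-1` U).
    by apply: (@cts_fun _ _ (homeo_inv h) (h x) U); rewrite homeo_funK.
  by case/(rs_basis R) => n nU; exists n => y /nU; rewrite /= homeo_funK.
- by move=> x y /(rs_inj R); exact: (can_inj (@homeo_funK _ _ h)).
- move=> c c_lt c_coh; have [b bc] := rs_complete R c_lt c_coh.
  by exists (homeo_inv h b) => n; rewrite homeo_invK.
Qed.

(** * Divisibility of periods and conjugacy *)

Section ResidueTheory.
Variables (X : topologicalType) (S : X -> X) (P : nat -> nat) (v : nat -> X -> nat).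
Hypothesis R : residue_system S P v.

Lemma rs_dvd_le m n : m <= n -> P m %| P n.
Proof.
by move=> /subnK <-; elim: (n - m) => // k IH; exact: dvdn_trans IH (rs_dvd R _).
Qed.

Lemma rs_le m n x : m <= n -> v m x = v n x %% P m.
Proof.
move=> /subnK <-; elim: (n - m) => [|k IHk]; first by rewrite modn_small ?(rs_lt R).
by rewrite IHk (rs_coh R (k + m)) addSn modn_dvdm // rs_dvd_le ?leq_addl.
Qed.

Lemma rs_iter n k x : v n (iter k S x) = (v n x + k) %% P n.
Proof.
elim: k => [|k IHk]; first by rewrite addn0 modn_small ?(rs_lt R).
by rewrite iterS (rs_succ R) IHk -addn1 modnDml addn1 addnS.
Qed.

Lemma rs_point : exists x : X, True.
Proof.
have [x _] := @rs_complete _ _ _ _ R (fun=> 0) (rs_gt0 R) (fun n => esym (mod0n _)).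
by exists x.
Qed.

End ResidueTheory.

Section Comparison.
Variables (X Y : topologicalType) (S : X -> X) (T : Y -> Y).
Variables (P Q : nat -> nat) (v : nat -> X -> nat) (w : nat -> Y -> nat).
Hypotheses (RX : residue_system S P v) (RY : residue_system T Q w).

(** The reductions from [Z/P n] to [Z/Q m] are compatible, so they induce a map of inverse
    limits. *)
Lemma residue_map_exists : (forall m, exists n, Q m %| P n) ->
  exists F : X -> Y, continuous F /\
    forall m n x, Q m %| P n -> w m (F x) = v n x %% Q m.
Proof.
move=> /choice[N QN].
(* The class modulo [Q m] does not depend on the level it is read from, so the arbitrary choice of
   [N] is harmless. *)
have vN x m n : Q m %| P n -> v n x %% Q m = v (N m) x %% Q m.
  move=> Qmn; case: (leqP n (N m)) => [|/ltnW] le.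
    by rewrite [in LHS](rs_le RX _ le) modn_dvdm.
  by rewrite [in RHS](rs_le RX _ le) modn_dvdm.
have /choice[F Fw] x : exists y, forall m, w m y = v (N m) x %% Q m.
  apply: (rs_complete RY) => n.
    by rewrite ltn_mod (rs_gt0 RY).
  rewrite modn_dvdm ?(rs_dvd RY) //; apply/esym/vN.
  exact: dvdn_trans (rs_dvd RY n) (QN _).
exists F; split=> [x U /(rs_basis RY)[m mU]|m n x Qmn]; last by rewrite Fw vN.
apply: filterS (rs_near RX (N m) x) => z /= E; apply: mU => /=.
by rewrite !Fw E.
Qed.

End Comparison.

Lemma residue_maps_cancel (X Y : topologicalType) (S : X -> X) (T : Y -> Y)
    P Q v w (F : X -> Y) (G : Y -> X) :
  residue_system S P v -> residue_system T Q w ->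
  (forall m, exists n, Q m %| P n) -> (forall m, exists n, P m %| Q n) ->
  (forall m n x, Q m %| P n -> w m (F x) = v n x %% Q m) ->
  (forall m n y, P m %| Q n -> v m (G y) = w n y %% P m) ->
  cancel F G.
Proof.
move=> RX RY QP PQ FE GE x; apply: (rs_inj RX) => m.
have [n Pmn] := PQ m; have [k Qnk] := QP n.
(* A level of [P] fine enough both to compute [w n (F x)] and to determine [v m x]. *)
have Qk : Q n %| P (maxn m k) by exact: dvdn_trans Qnk (rs_dvd_le RX (leq_maxr _ _)).
by rewrite (GE m n) // (FE _ _ _ Qk) modn_dvdm // -(rs_le RX) // leq_maxl.
Qed.

Lemma residue_systems_conjugate (X Y : topologicalType) (S : X -> X) (T : Y -> Y)
    P Q v w :
  residue_system S P v -> residue_system T Q w ->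
  (forall m, exists n, Q m %| P n) -> (forall m, exists n, P m %| Q n) ->
  exists h : homeo X Y, forall x, h (S x) = T (h x).
Proof.
move=> RX RY QP PQ.
have [F [Fc FE]] := residue_map_exists RX RY QP.
have [G [Gc GE]] := residue_map_exists RY RX PQ.
have FK := residue_maps_cancel RX RY QP PQ FE GE.
have GK := residue_maps_cancel RY RX PQ QP GE FE.
exists (@Homeo _ _ (mkcts Fc) (mkcts Gc) FK GK) => x /=.
apply: (rs_inj RY) => m; have [n Qmn] := QP m.
rewrite (rs_succ RY) !(FE _ _ _ Qmn) (rs_succ RX) modn_dvdm //.
by rewrite -addn1 -[in RHS]addn1 modnDml.
Qed.

(** * Sets met exactly once by every orbit segment of length [d] *)

Section CyclicPredicate.
Variables (X : Type) (S : X -> X) (d : nat) (u : X -> bool).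
Hypothesis u1 : forall x, \sum_(i < d) u (iter i S x) = 1.

Lemma cyclic_shift x : u (iter d S x) = u x.
Proof.
(* Splitting off the last term on one side and the first on the other leaves two windows of length
   [d], each of sum 1. *)
have E : \sum_(i < d.+1) u (iter i S x) = \sum_(i < d.+1) u (iter i S x) by [].
move: E; rewrite {1}big_ord_recr big_ord_recl u1 /=.
under [X in _ = _ + X]eq_bigr => i _ do rewrite -iterS iterSr.
by rewrite u1 addnC => /addIn; do 2!case: (u _).
Qed.

Lemma cyclic_exists (x : X) : exists y, u y.
Proof.
apply: contrapT => nu; have := u1 x; rewrite big1 // => i _.
by case: (boolP (u _)) => // ui; case: nu; exists (iter i S x).
Qed.

Lemma cyclic_dvd k x : 0 < d -> u x -> u (iter k S x) -> d %| k.
Proof.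
move=> d0 ux; have -> : u (iter k S x) = u (iter (k %% d) S x).
  rewrite {1}(divn_eq k d); elim: (k %/ d) => // q IHq.
  by rewrite mulSn -addnA iterD cyclic_shift.
have rd : k %% d < d by rewrite ltn_mod.
move=> ur; apply/negPn; rewrite /dvdn -lt0n; apply/negP => r0.
(* A nonzero remainder would give two visits, at times 0 and [k %% d], within one window. *)
have := u1 x; rewrite (bigD1 (Ordinal d0)) //= ux (bigD1 (Ordinal rd)) /= ?ur //.
by rewrite -val_eqE /= -lt0n.
Qed.

End CyclicPredicate.

Lemma sum_residue_class d k : k < d -> \sum_(i < d) ((k + i) %% d == 0) = 1.
Proof.
move=> kd; have d0 : 0 < d by exact: leq_ltn_trans kd.
(* The only index that contributes; the reduction matters for [k = 0], where [d - k] is out of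
   range. *)
have jd : (d - k) %% d < d by rewrite ltn_mod.
rewrite (bigD1 (Ordinal jd)) //= modnDmr subnKC ?modnn 1?ltnW // big1 // => i.
rewrite -val_eqE /= => ij; case: eqP => // ki; case/eqP: ij.
rewrite -[LHS](modn_small (ltn_ord i)); apply/eqP.
by rewrite -(eqn_modDl k) subnKC ?modnn ?ki // ltnW.
Qed.

Local Open Scope ring_scope.
Local Open Scope complex_scope.

(** * Complex modulus and supremum norm *)

Section ComplexNorm.
Variable R : realType.
Implicit Types z w : R[i].

Lemma normcD z w : normc (z + w) <= normc z + normc w.
Proof. exact: le_normcD. Qed.

Lemma normcB z w : normc (z - w) = normc (w - z).
Proof. by rewrite -opprB; exact: normcN. Qed.

Lemma normc_nat n : normc (n%:R : R[i]) = n%:R.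
Proof. by rewrite (normcMn (1 : R[i])) normc1. Qed.

Lemma normc_ge0 z : 0 <= normc z.
Proof. by case: z => a b; exact: sqrtr_ge0. Qed.

(** Both summands are nonnegative reals, so nothing cancels: one norm controls two relations at
    once. *)
Lemma normc_sqrD z w :
  normc (z * z^* + w * w^*) = normc z ^+ 2 + normc w ^+ 2.
Proof.
have E t : t * t^* = (normc t ^+ 2)%:C by rewrite -sqr_normc rmorphXn.
rewrite !E -rmorphD /= expr0n addr0 sqrtr_sqr ger0_norm //.
by rewrite addr_ge0 ?sqr_ge0.
Qed.

End ComplexNorm.

Section NormOfContinuousFunctions.
Variables (R : realType) (X : topologicalType).
Implicit Types f : CX R X.

Lemma continuous_normc f : continuous (fun x => normc (f x)).
Proof.
move=> x; apply/cvgrPdist_lt => e e0.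
have e0' : 0 < e%:C :> R[i] by rewrite ltcR.
have /(@cvgrPdist_lt _ R[i]^o)/(_ _ e0') := @CX_cvg R X f x.
apply: filterS => y /= fxy; apply: (@le_lt_trans _ _ (normc (f x - f y))).
  rewrite ler_norml.
  have := normcD (f x - f y) (f y); rewrite subrK.
  have := normcD (f y - f x) (f x); rewrite subrK (normcB (f y)); lra.
by rewrite -ltcR.
Qed.

Lemma open_normc_ball f (z : R[i]) e x : normc (f x - z) < e ->
  nbhs x [set y | normc (f y - z) < e].
Proof.
move=> xe.
have c : continuous ((fun y => f y - z) : X -> R[i]^o).
  by move=> y; apply: (@cvgB _ R[i]^o); [exact: CX_cvg | exact: cvg_cst].
have := @continuous_normc (mkcts c) x => /(_ [set r | r < e]); apply.
by apply: open_nbhs_nbhs; split => //; exact: open_lt.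
Qed.

(** Compactness bounds the range, so that [sup] is a true supremum and not its default value. *)
Lemma CX_norm_ge f x : compact [set: X] -> normc (f x) <= CX_norm f.
Proof.
move=> cX; apply: ub_le_sup; last by exists x.
have : compact (range (fun x => normc (f x))).
  by apply: continuous_compact => //; apply: continuous_subspaceT; exact: continuous_normc.
move=> /(@compact_bounded R R)[M [_ /(_ (M + 1))]].
rewrite ltrDl => /(_ ltr01) B; exists (M + 1) => r /B.
exact/le_trans/ler_norm.
Qed.

Lemma CX_norm_le f (r : R) (x0 : X) :
  (forall x, normc (f x) <= r) -> CX_norm f <= r.
Proof.
move=> fr; apply: ge_sup; first by exists (normc (f x0)), x0.
by move=> _ [x _ <-].
Qed.

Lemma CX_norm_ge0 f (x0 : X) : compact [set: X] -> 0 <= CX_norm f.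
Proof. by move=> cX; apply: le_trans (CX_norm_ge f x0 cX); exact: normc_ge0. Qed.

End NormOfContinuousFunctions.

Lemma cantor_compact (X : topologicalType) : is_cantor_set X -> compact [set: X].
Proof.
move=> [h].
have -> : [set: X] = homeo_inv h @` [set: cantor_space].
  by apply/seteqP; split=> x // _; exists (h x) => //; rewrite homeo_funK.
apply: continuous_compact; last exact: cantor_space_compact.
by apply: continuous_subspaceT => x; exact: cts_fun.
Qed.

(** * The sentence detecting a period *)

Section CyclicSentence.
Variable R : realType.

Definition cyclic_var : term R 1 := TVar R ord0.

(** Horner form [x + sigma (x + sigma (...))] of the sum of the first [d] iterates. *)
Definition cyclic_sum d : term R 1 :=
  iter d (fun t => TAdd cyclic_var (TSigma t)) (TZero R 1).

Definition square_norm (t : term R 1) := TMul t (TStar t).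

(** Self-adjointness needs no relation of its own: an idempotent function takes only the values 0
    and 1. *)
Definition cyclic_term d : term R 1 :=
  TAdd (square_norm (TAdd (TMul cyclic_var cyclic_var) (TScale (-1) cyclic_var)))
       (square_norm (TAdd (cyclic_sum d) (TScale (-1) (TOne R 1)))).

Definition cyclic_sentence d : sentence R := FInf 1 (FNorm (cyclic_term d)).

Section Evaluation.
Variables (X : topologicalType) (S : homeo X X).
Let M := C_of R S.
Implicit Types f : CX R X.

Definition cyclic_defect d f : R :=
  L_norm (eval_term (@extend R M 0 f (no_var M)) (cyclic_term d)).

Lemma eval_cyclic_var f : eval_term (@extend R M 0 f (no_var M)) cyclic_var = f.
Proof. by rewrite /= /extend unlift_none. Qed.

Lemma eval_cyclic_sum d f x :
  (eval_term (@extend R M 0 f (no_var M)) (cyclic_sum d) : CX R X) x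
  = \sum_(i < d) f (iter i S x).
Proof.
elim: d x => [|d IHd] x; first by rewrite big_ord0.
transitivity ((eval_term (@extend R M 0 f (no_var M)) cyclic_var : CX R X) x
  + (eval_term (@extend R M 0 f (no_var M)) (cyclic_sum d) : CX R X) (S x)) => //.
rewrite eval_cyclic_var big_ord_recl IHd; congr (_ + _).
by apply: eq_bigr => i _; rewrite -iterSr.
Qed.

Lemma eval_cyclic_term d f x :
  normc ((eval_term (@extend R M 0 f (no_var M)) (cyclic_term d) : CX R X) x)
  = normc (f x * f x - f x) ^+ 2
    + normc (\sum_(i < d) f (iter i S x) - 1) ^+ 2.
Proof.
rewrite -eval_cyclic_sum -normc_sqrD.
pose ev t : CX R X := eval_term (@extend R M 0 f (no_var M)) t.
have fE : ev cyclic_var = f by exact: eval_cyclic_var.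
transitivity (normc (
    (ev cyclic_var x * ev cyclic_var x + -1 * ev cyclic_var x)
    * (ev cyclic_var x * ev cyclic_var x + -1 * ev cyclic_var x)^*
  + (ev (cyclic_sum d) x + -1 * 1) * (ev (cyclic_sum d) x + -1 * 1)^*)) => //.
by rewrite fE !mulN1r.
Qed.

Lemma cyclic_sentenceE d : sentence_value M (cyclic_sentence d) =
  inf [set cyclic_defect d f | f in [set f : CX R X | CX_norm f <= 1]].
Proof. by []. Qed.

End Evaluation.
End CyclicSentence.

Section CyclicSentenceOdometer.
Variables (R : realType) (X : topologicalType) (S : homeo X X).
Variables (P : nat -> nat) (v : nat -> X -> nat).
Hypothesis RS : residue_system S P v.
Hypothesis cX : compact [set: X].

Lemma cyclic_defect_ge0 d (f : CX R X) : 0 <= cyclic_defect S d f.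
Proof. by have [x _] := rs_point RS; exact: CX_norm_ge0. Qed.

Lemma residue_indicator_continuous n :
  continuous ((fun x => (v n x == 0%N)%:R) : X -> R[i]^o).
Proof.
move=> x U xU; apply: filterS (rs_near RS n x) => y /= ->.
exact: nbhs_singleton xU.
Qed.

(** The infimum is attained at the indicator of the class 0 modulo [P n], which every orbit meets
    once in [P n] consecutive steps. *)
Lemma cyclic_sentence_period n :
  sentence_value (C_of R S) (cyclic_sentence R (P n)) = 0.
Proof.
have [x0 _] := rs_point RS.
pose f : CX R X := mkcts (@residue_indicator_continuous n).
have fE x : f x = (v n x == 0%N)%:R :> R[i] by [].
have f0 : cyclic_defect S (P n) f = 0.
  apply/le_anti; rewrite cyclic_defect_ge0 andbT.
  apply: (CX_norm_le x0) => x; rewrite eval_cyclic_term.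
  have -> : f x * f x - f x = 0.
    by rewrite fE; case: (v n x == 0%N); rewrite ?mul1r ?mul0r subrr.
  have -> : \sum_(i < P n) f (iter i S x) = 1.
    under eq_bigr => i _ do rewrite fE (rs_iter RS).
    by rewrite -natr_sum sum_residue_class ?(rs_lt RS).
  by rewrite subrr normc0 expr0n addr0.
have f1 : CX_norm f <= 1.
  apply: (CX_norm_le x0) => x; rewrite fE.
  by case: (v n x == 0%N); rewrite normc_nat ?ler01.
rewrite cyclic_sentenceE; apply/le_anti/andP; split.
  rewrite -f0; apply: ge_inf; last by exists f.
  by exists 0 => _ [g _ <-]; exact: cyclic_defect_ge0.
apply: lb_le_inf; first by exists (cyclic_defect S (P n) f), f.
by move=> _ [g _ <-]; exact: cyclic_defect_ge0.
Qed.

(** A vanishing infimum yields defects below [e ^+ 2]; as the defect is a sum of two squares, each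
    relation then holds up to [e]. *)
Lemma cyclic_sentence_approx d (e : R) : 0 < e ->
  sentence_value (C_of R S) (cyclic_sentence R d) = 0 ->
  exists f : CX R X, forall x, normc (f x * f x - f x) < e /\
    normc (\sum_(i < d) f (iter i S x) - 1) < e.
Proof.
move=> e0; rewrite cyclic_sentenceE => phi0.
have [x0 _] := rs_point RS.
have e2 : 0 < e ^+ 2 by rewrite exprn_gt0.
rewrite -phi0 in e2; case: (inf_lt _ e2).
  (* Any function of the unit ball shows that the infimum is over a nonempty set. *)
  exists (cyclic_defect S d (cst 0 : CX R X)), (cst 0 : CX R X) => //=.
  by apply: (CX_norm_le x0) => x; rewrite -[normc _]/(normc (0 : R[i])) normc0.
move=> _ [f _ <-] fe; exists f => x.
have := le_lt_trans (CX_norm_ge _ x cX) fe; rewrite eval_cyclic_term => h.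
by split; rewrite -(@ltr_pXn2r _ 2) ?nnegrE ?normc_ge0 ?(ltW e0) //;
  apply: le_lt_trans h; rewrite ?lerDl ?lerDr exprn_ge0 ?normc_ge0.
Qed.

End CyclicSentenceOdometer.

(** * Rounding approximate solutions to exact ones *)

Section Approximation.
Variable R : realType.

(** One of [z] and [z - 1] has modulus at least 1/2, and their product is below [e / 2], so the
    other one is below [e]. The boolean selects the nearby idempotent 1 or 0. *)
Lemma near_idempotent (z : R[i]) (e : R) : e <= 1 ->
  normc (z * z - z) < e / 2 -> normc (z - (normc (z - 1) < e)%R%:R) < e.
Proof.
move=> e1; have [//|ez] := ltP (normc (z - 1)) e.
rewrite subr0 -{3}[z]mulr1 -mulrBr normcM => h.
have t : 1 <= normc z + normc (z - 1).
  by have := normcD z (1 - z); rewrite addrC subrK normc1 (normcB 1).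
rewrite ltNge; apply/negP => za; have := normc_ge0 z; have := normc_ge0 (z - 1).
by have [] := leP (1 / 2) (normc z); nra.
Qed.

Lemma normc_sum_dist (d : nat) (g h : 'I_d -> R[i]) (e : R) :
  (forall i, normc (g i - h i) < e) ->
  normc (\sum_(i < d) g i - \sum_(i < d) h i) <= d%:R * e.
Proof.
elim: d g h => [|d IHd] g h gh; first by rewrite !big_ord0 subrr normc0 mul0r.
rewrite !big_ord_recl opprD addrACA mulrS mulrDl mul1r.
by apply: le_trans (normcD _ _) _; apply: lerD; [exact: ltW|exact: IHd].
Qed.

Lemma normc_nat_near1 (n : nat) : normc (n%:R - 1 : R[i]) < 1 -> n = 1%N.
Proof.
case: n => [|n]; first by rewrite normcB subr0 normc1 ltxx.
by rewrite mulrS addrAC subrr add0r normc_nat ltrn1 ltnS leqn0 => /eqP ->.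
Qed.

End Approximation.

Section PeriodFromSentence.
Variables (R : realType) (X : topologicalType) (S : homeo X X).
Variables (P : nat -> nat) (v : nat -> X -> nat).
Hypothesis RS : residue_system S P v.
Hypothesis cX : compact [set: X].

Lemma cyclic_sentence_dvd d : (0 < d)%N ->
  sentence_value (C_of R S) (cyclic_sentence R d) = 0 -> exists n, (d %| P n)%N.
Proof.
(* Rounding [d] values costs at most [d * e = 1/4], and the approximate sum is within [e / 2] of 1;
   the total stays below 1, which forces an integer to equal 1. *)
move=> d0; pose e : R := (4 * d%:R)^-1.
have dR : 1 <= d%:R :> R by rewrite ler1n.
have dR0 : 0 < 4 * d%:R :> R by rewrite mulr_gt0 // ltr0n.
have e0 : 0 < e by rewrite invr_gt0.
have de : d%:R * e = 1 / 4.
  by rewrite /e; field; rewrite pnatr_eq0 -lt0n.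
have e4 : e <= 1 / 4 by rewrite -de ler_peMl // ltW.
have e2 : 0 < e / 2 by lra.
move=> /(cyclic_sentence_approx RS cX e2)[f fP].
pose u x := normc (f x - 1) < e.
have fu x : normc (f x - (u x)%:R) < e.
  by apply: near_idempotent; [lra | have [] := fP x].
have u1 x : (\sum_(i < d) u (iter i S x) = 1)%N.
  apply: (@normc_nat_near1 R); rewrite natr_sum.
  have [_ h1] := fP x.
  have h2 := normc_sum_dist (fun i : 'I_d => fu (iter i S x)).
  rewrite normcB de in h2.
  apply: le_lt_trans (_ : 1 / 4 + e / 2 < 1); last by lra.
  rewrite -(subrKA (\sum_(i < d) f (iter i S x))).
  by apply: le_trans (normcD _ _) _; apply: lerD => //; exact: ltW.
have [x0 _] := rs_point RS.
have [x ux] := cyclic_exists u1 x0.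
(* The rounded set is open, so it contains the whole class of [x] modulo some [P n]. After [P n]
   steps the orbit is back in that class, and return times are multiples of [d]. *)
have [n nU] := rs_basis RS (open_normc_ball ux).
exists n; apply: (cyclic_dvd u1 d0 ux); apply: nU => /=.
by rewrite (rs_iter RS) modnDr modn_small // (rs_lt RS).
Qed.

End PeriodFromSentence.

(** The sentence for [Q m] vanishes on the side of [Y], hence on the side of [X], where its
    vanishing forces divisibility. *)
Lemma elementarily_equivalent_periods (R : realType) (X Y : topologicalType)
    (S : homeo X X) (T : homeo Y Y) P Q v w :
  residue_system S P v -> residue_system T Q w ->
  compact [set: X] -> compact [set: Y] ->
  elementarily_equivalent (C_of R S) (C_of R T) ->
  forall m, exists n, (Q m %| P n)%N.
Proof.
move=> RX RY cX cY E m; apply: (cyclic_sentence_dvd (R := R) RX cX).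
  exact: (rs_gt0 RY).
by rewrite E (cyclic_sentence_period R RY cY).
Qed.

(** * From conjugacy to isomorphism to equal values of sentences *)

Lemma conjugate_isomorphic (R : realType) (X Y : topologicalType)
    (S : homeo X X) (T : homeo Y Y) (h : homeo X Y) :
  (forall x, h (S x) = T (h x)) -> isomorphic (C_of R S) (C_of R T).
Proof.
move=> hS.
pose pull (Z W : topologicalType) (k : continuousType W Z) (f : CX R Z) : CX R W := f \o k.
have ext (Z : topologicalType) (f g : CX R Z) : f =1 g -> f = g.
  by move=> fg; apply/continuousEP.
exists (pull _ _ (homeo_inv h)); split.
- by exists (pull _ _ h) => f; apply: ext => x; rewrite /= ?homeo_funK ?homeo_invK.
- exact: ext.
- exact: ext.
- by move=> f g; exact: ext.
- by move=> f g; exact: ext.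
- by move=> f; exact: ext.
- by move=> c f; exact: ext.
- move=> f; apply: ext => y /=; congr (f _).
  (* The inverse of a conjugacy intertwines [T] with [S]. *)
  by rewrite -[y in RHS](@homeo_invK _ _ h y) -hS homeo_funK.
- move=> f; rewrite /= /CX_norm; congr sup; apply/seteqP; split=> _ [x _ <-].
    by exists (homeo_inv h x).
  by exists (h x) => //=; rewrite homeo_funK.
Qed.

Lemma isomorphic_equivalent (R : realType) (M N : Lstructure R) :
  isomorphic M N -> elementarily_equivalent M N.
Proof.
move=> [F FI].
have termF k (t : term R k) (x : 'I_k -> M) :
    F (eval_term x t) = eval_term (F \o x) t.
  elim: t => //= [||t1 E1 t2 E2|t1 E1 t2 E2|t E|c t E|t E].
  - exact: iso_zero FI.
  - exact: iso_one FI.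
  - by rewrite (iso_add FI) E1 E2.
  - by rewrite (iso_mul FI) E1 E2.
  - by rewrite (iso_star FI) E.
  - by rewrite (iso_scale FI) E.
  - by rewrite (iso_sigma FI) E.
have extF k (y : M) (x : 'I_k -> M) : extend (F y) (F \o x) = F \o extend y x.
  by apply: funext => i; rewrite /extend /=; case: (unlift _ _).
have [G FK GK] := iso_bij FI.
(* An isometric bijection carries each ball onto the ball of the same radius, so both quantifiers
   range over equal sets of values, default cases included. *)
have quantF k (psi : formula R k.+1) (n : nat) (x : 'I_k -> M) :
    (forall y, eval_formula psi y = eval_formula psi (F \o y)) ->
    [set eval_formula psi (extend y x) | y in @L_ball R M n] =
    [set eval_formula psi (extend y (F \o x)) | y in @L_ball R N n].
  move=> IH; apply/seteqP; split=> _ [y yn <-].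
    by exists (F y); rewrite ?IH ?extF // /L_ball /= (iso_norm FI).
  exists (G y); last by rewrite IH -extF GK.
  by rewrite /L_ball /= -(iso_norm FI) GK.
have formF k (phi : formula R k) (x : 'I_k -> M) :
    eval_formula phi x = eval_formula phi (F \o x).
  elim: phi x => {k} /= [k t|k m f phis IH|k n psi IH|k n psi IH] x.
  - by rewrite -termF (iso_norm FI).
  - by congr (f _); apply: funext => j.
  - by rewrite quantF.
  - by rewrite quantF.
move=> phi; rewrite /sentence_value formF; congr eval_formula.
by apply: funext => -[].
Qed.

Theorem theorem2p4 (R : realType) (X Y : topologicalType)
    (sigma : homeo X X) (tau : homeo Y Y)
    (cantorX : is_cantor_set X) (cantorY : is_cantor_set Y)
    (odoX : is_odometer sigma) (odoY : is_odometer tau) :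
  elementarily_equivalent (C_of R sigma) (C_of R tau)
  <-> isomorphic (C_of R sigma) (C_of R tau).
Proof.
split=> [E|]; last exact: isomorphic_equivalent.
have [P [v RX]] := is_odometer_residue_system odoX.
have [Q [w RY]] := is_odometer_residue_system odoY.
have cX := cantor_compact cantorX; have cY := cantor_compact cantorY.
have QP := elementarily_equivalent_periods RX RY cX cY E.
(* Equivalence is symmetric, so the periods of each system divide periods of the other. *)
have PQ := elementarily_equivalent_periods RY RX cY cX (fun phi => esym (E phi)).
by have [h /conjugate_isomorphic] := residue_systems_conjugate RX RY QP PQ.
Qed.
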